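(* Let $\gamma \geq 2$ be a fixed rational number. If a deterministic algorithm for the minimum, sorting, or MST problem under uncertainty is $\gamma$-robust, then its competitive ratio on instances with $k_M = 0$ cannot be better than $1 + \frac{1}{\gamma-1}$. Furthermore, if an algorithm has competitive ratio $1 + \frac{1}{\gamma-1}$ on instances with $k_M = 0$, then it cannot be better than $\gamma$-robust.
   Context: Each uncertain element $i$ has an interval $I_i$ that is open $(L_i,U_i)$ or trivial $\{w_i\}$, an unknown true value $w_i\in I_i$ (revealed by a query) and a predicted value $\bar w_i\in I_i$. Minimum problem: given intervals and a family $\mathcal{S}$ of subsets, determine for each set an element of minimum true value. Sorting problem: determine for each set the order by true value. MST problem: graph with an interval per edge weight; determine a spanning tree that is an MST for the true weights. A query set $Q$ is feasible if the answer is the same for all value assignments in the intervals agreeing with the true values on $Q$; $\mathrm{opt}$ is the minimum size of a feasible query set. An algorithm queries adaptively until its queries form a feasible set; $|\mathrm{ALG}|$ is its number of queries. It has competitive ratio $\rho$ on a class of instances if $|\mathrm{ALG}|\le\rho\cdot\mathrm{opt}$ on every instance of the class; it is $\beta$-robust if it has competitive ratio $\beta$ on all instances. An element is mandatory if it belongs to every feasible query set, and prediction mandatory if it belongs to every feasible query set when the true values are assumed to equal the predictions; with $\mathcal{I}_R$, $\mathcal{I}_P$ these sets, $k_M=|\mathcal{I}_P\triangle\mathcal{I}_R|$. *)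

(* Defs.v *)
From HB Require Import structures.
From mathcomp Require Import all_boot all_order all_algebra.
From mathcomp Require Import boolp reals.

Set Implicit Arguments.
Unset Strict Implicit.
Unset Printing Implicit Defensive.

Import Order.TTheory GRing.Theory Num.Theory.
Local Open Scope ring_scope.

Inductive uncertainty_interval (R : realType) : Type :=
| OpenItv of R & R
| TrivialItv of R.

Definition in_uitv (R : realType) (x : R) (J : uncertainty_interval R) : Prop :=
  match J with
  | OpenItv L U => L < x /\ x < U
  | TrivialItv c => x = c
  end.

(* A problem on [n] uncertain elements: combinatorial data, candidate answers,
   and when an answer is correct for given values of the elements. *)
Record problem (R : realType) : Type := Problem {
  data : nat -> Type;
  answer : forall n, data n -> Type;
  correct : forall (n : nat) (D : data n), ('I_n -> R) -> answer D -> Prop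
}.
Arguments correct {R} p {n} D.

Record set_family (n : nat) : Type := SetFamily {
  nsets : nat;
  member : 'I_nsets -> {set 'I_n};
  member_neq0 : forall j, member j != set0
}.

Definition minimum_problem (R : realType) : problem R :=
  @Problem R set_family
    (fun n F => 'I_(nsets F) -> 'I_n)
    (fun n F w a => forall j : 'I_(nsets F),
       a j \in member j /\ forall i, i \in member j -> w (a j) <= w i).

(* The order of a set is given by the sequence of its elements by
   non-decreasing value. *)
Definition sorting_problem (R : realType) : problem R :=
  @Problem R set_family
    (fun n F => 'I_(nsets F) -> seq 'I_n)
    (fun n F w a => forall j : 'I_(nsets F),
       perm_eq (a j) (enum (member j)) /\
       sorted (fun i k => w i <= w k) (a j)).

Section Graphs.
Variables (n m : nat) (ends : 'I_n -> {set 'I_m}).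

Definition adjacent (T : {set 'I_n}) : rel 'I_m :=
  [rel u v | [exists e in T, ends e == [set u; v]]].

Definition connected_graph (T : {set 'I_n}) : Prop :=
  forall u v : 'I_m, connect (adjacent T) u v.

(* In a simple graph, cycles are the cyclic sequences of at least three
   distinct vertices. *)
Definition acyclic_graph (T : {set 'I_n}) : Prop :=
  forall c : seq 'I_m, (2 < size c)%N -> ~ ucycle (adjacent T) c.

Definition spanning_tree (T : {set 'I_n}) : Prop :=
  connected_graph T /\ acyclic_graph T.

Definition is_mst (R : realType) (w : 'I_n -> R) (T : {set 'I_n}) : Prop :=
  spanning_tree T /\
  forall T' : {set 'I_n}, spanning_tree T' ->
    \sum_(e in T) w e <= \sum_(e in T') w e.
End Graphs.

(* Finite connected simple graphs with [n] edges. *)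
Record graph (n : nat) : Type := Graph {
  nverts : nat;
  ends : 'I_n -> {set 'I_nverts};
  nverts_gt0 : (0 < nverts)%N;
  card_ends : forall e, #|ends e| = 2%N;
  ends_inj : injective ends;
  graph_connected : connected_graph ends [set: 'I_n]
}.

Definition mst_problem (R : realType) : problem R :=
  @Problem R graph
    (fun n _ => {set 'I_n})
    (fun n G w T => is_mst (@ends n G) w T).

Inductive problem_kind : Type := Minimum | Sorting | MST.

Definition problem_of (R : realType) (p : problem_kind) : problem R :=
  match p with
  | Minimum => minimum_problem R
  | Sorting => sorting_problem R
  | MST => mst_problem R
  end.

(* What an algorithm knows before any query. *)
Record input (R : realType) (P : problem R) : Type := Input {
  nelts : nat;
  input_data : data P nelts;
  uitv : 'I_nelts -> uncertainty_interval R;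
  predicted : 'I_nelts -> R;
  predicted_in : forall i, in_uitv (predicted i) (uitv i)
}.

Record instance (R : realType) (P : problem R) : Type := Instance {
  input_of :> input P;
  true_value : 'I_(nelts input_of) -> R;
  true_value_in : forall i, in_uitv (true_value i) (uitv i)
}.

Section Queries.
Variables (R : realType) (P : problem R).

(* [Q] is feasible when the values are [w]: some answer is correct for every
   assignment that lies in the intervals and agrees with [w] on [Q] (correct
   answers need not be unique, because values may coincide). *)
Definition feasible (J : input P) (w : 'I_(nelts J) -> R)
    (Q : {set 'I_(nelts J)}) : Prop :=
  exists a : answer (input_data J), forall w' : 'I_(nelts J) -> R,
    (forall i, in_uitv (w' i) (uitv i)) ->
    (forall i, i \in Q -> w' i = w i) ->
    correct P (input_data J) w' a.

Definition mandatory_set (J : input P) (w : 'I_(nelts J) -> R) :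
    {set 'I_(nelts J)} :=
  [set i | `[< forall Q, feasible w Q -> i \in Q >]].

Definition I_R (I : instance P) := mandatory_set (@true_value R P I).
Definition I_P (I : instance P) := mandatory_set (@predicted R P I).

Definition k_M (I : instance P) : nat :=
  #|(I_P I :\: I_R I) :|: (I_R I :\: I_P I)|.

(* [setT] is a legitimate starting point: querying everything is feasible. *)
Definition opt (I : instance P) : nat :=
  #|[arg min_(Q < [set: 'I_(nelts I)] | `[< feasible (@true_value R P I) Q >])
       #|Q| ]|%N.

(* The history lists the queried elements with the revealed values, oldest
   first. The output is the next element to query; [None] means that the
   algorithm gives up, which never counts as a successful run. *)
Definition algorithm : Type :=
  forall J : input P, seq ('I_(nelts J) * R) -> option 'I_(nelts J).

(* [alg_cost A h k]: after history [h], [A] makes exactly [k] further queries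
   until its queries form a feasible set. *)
Inductive alg_cost (A : algorithm) (I : instance P) :
    seq ('I_(nelts I) * R) -> nat -> Prop :=
| AlgStop h :
    feasible (@true_value R P I) [set i in unzip1 h] ->
    alg_cost A h 0
| AlgQuery h i k :
    ~ feasible (@true_value R P I) [set i in unzip1 h] ->
    A I h = Some i ->
    alg_cost A (rcons h (i, true_value i)) k ->
    alg_cost A h k.+1.

Definition competitive_on (A : algorithm) (C : instance P -> Prop) (rho : R) :
    Prop :=
  forall I : instance P, C I ->
    exists k : nat, @alg_cost A I [::] k /\ k%:R <= rho * (opt I)%:R.

Definition robust (A : algorithm) (beta : R) : Prop :=
  competitive_on A (fun _ => True) beta.

End Queries.

(* Main.v *)
Require Import Defs.
From HB Require Import structures.
From mathcomp Require Import all_boot all_order all_algebra.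
From mathcomp Require Import boolp reals.
From mathcomp Require Import zify ring lra.

Set Implicit Arguments.
Unset Strict Implicit.
Unset Printing Implicit Defensive.

Import Order.TTheory GRing.Theory Num.Theory.
Local Open Scope ring_scope.

(** Take [l] "left" elements with interval (0, 8), predicted inside the overlap
    with the [r] "right" intervals (4, 12), and right elements predicted outside
    it, and ask for all comparisons between left and right. The adversary reveals
    values outside the overlap, except for the query that completes the left or
    the right side, which it answers inside the overlap; then the whole other side
    must be queried too, so the algorithm makes at least [l + r] queries. If the
    left side is completed first, then opt <= r and the mandatory elements are
    exactly the right ones, as predicted, so k_M = 0; otherwise opt <= l. Hence
    l + r <= rho r or l + r <= beta l for all [l] and [r], and choosing
    (l + r) / l just above, respectively just below, gamma and letting [l] tend to
    infinity gives the two bounds. For spanning trees, the left edges form a path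
    and the right edges are parallel to it, each subdivided by an edge of weight 0
    to keep the graph simple. *)

(** * Trees given by parent edges *)

Lemma set2_eq (T : finType) (a b c d : T) :
  [set a; b] = [set c; d] -> (a = c /\ b = d) \/ (a = d /\ b = c).
Proof.
move=> E.
have /set2P ac : a \in [set c; d] by rewrite -E set21.
have /set2P bd : b \in [set c; d] by rewrite -E set22.
have /set2P ca : c \in [set a; b] by rewrite E set21.
have /set2P da : d \in [set a; b] by rewrite E set22.
by intuition congruence.
Qed.

Section Trees.
Variables (n m : nat) (ends : 'I_n -> {set 'I_m}).

Lemma adjacent_sym (T : {set 'I_n}) : symmetric (adjacent ends T).
Proof. by move=> u v; rewrite /adjacent /= setUC. Qed.

(** A vertex set of size [k.+1] containing [k] edges of [T] grows by an edge leaving it, which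
    connectivity provides while vertices remain outside. *)
Lemma connected_card (T : {set 'I_n}) :
  connected_graph ends T -> (m <= #|T|.+1)%N.
Proof.
move=> conn; case: (posnP m) => [->//|m_gt0].
have grow k : (k < m)%N -> exists (S : {set 'I_m}) (F : {set 'I_n}),
    [/\ #|S| = k.+1, #|F| = k, F \subset T
      & forall e, e \in F -> ends e \subset S].
  elim: k => [_|k IHk lt_km].
    exists [set Ordinal m_gt0], set0; split; rewrite ?cards1 ?cards0 ?sub0set //.
    by move=> e; rewrite inE.
  have [S [F [cS cF FT FS]]] := IHk (ltnW lt_km).
  have [x xS] : exists x, x \in S by apply/card_gt0P; rewrite cS.
  have [y yS] : exists y, y \in ~: S.
    by apply/card_gt0P; rewrite cardsCs setCK card_ord cS subn_gt0.
  rewrite inE in yS.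
  have [/existsP[u /existsP[v /and3P[uS vS /existsP[e /andP[eT /eqP Ee]]]]]|nocross] :=
      boolP [exists u, exists v, [&& u \in S, v \notin S & adjacent ends T u v]].
    exists (v |: S), (e |: F); split.
    - by rewrite cardsU1 vS cS.
    - rewrite cardsU1 cF; suff -> : e \notin F by [].
      apply: contra vS => eF; apply: (subsetP (FS _ eF)).
      by rewrite Ee set22.
    - by rewrite subUset sub1set eT.
    - move=> f /setU1P[->|fF].
        by rewrite Ee subUset !sub1set in_setU1 uS setU11 orbT.
      by apply: subset_trans (FS f fF) _; exact: subsetUr.
  have cl : closed (adjacent ends T) S.
    apply: intro_closed => [|u v uv uS].
      by apply: sym_connect_sym; exact: adjacent_sym.
    apply/negPn/negP => vS; case/existsP: nocross.
    by exists u; apply/existsP; exists v; rewrite uS vS.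
  by move: yS; rewrite -(closed_connect cl (conn x y)) xS.
have /grow[S [F [_ cF FT _]]] : (m.-1 < m)%N by rewrite prednK.
by rewrite -(prednK m_gt0) ltnS -cF subset_leq_card.
Qed.

(* [top e] is the endpoint of [e] further from the root, so that [e] joins
   [top e] to its parent [bot e]; [h] is any strictly increasing height. *)
Lemma parents_spanning_tree (T : {set 'I_n}) (top bot : 'I_n -> 'I_m)
    (h : 'I_m -> nat) (root : 'I_m) :
  (forall e, e \in T -> ends e = [set top e; bot e]) ->
  (forall e, e \in T -> (h (bot e) < h (top e))%N) ->
  {in T &, injective top} ->
  (forall v, v != root -> exists2 e, e \in T & top e = v) ->
  spanning_tree ends T.
Proof.
move=> Eends lt_h top_inj top_onto; split.
  have to_root k v : (h v <= k)%N -> connect (adjacent ends T) v root.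
    elim: k v => [|k IHk] v le_vk; have [->|/top_onto[e eT Ev]] := eqVneq v root;
      rewrite ?connect0 //; have := lt_h e eT; rewrite Ev; first by lia.
    move=> lt_ev; apply: (@connect_trans _ _ (bot e)); last by apply: IHk; lia.
    by apply: connect1; apply/existsP; exists e; rewrite eT Eends // Ev eqxx.
  move=> u v; apply: connect_trans (to_root _ _ (leqnn (h u))) _.
  rewrite (sym_connect_sym (adjacent_sym T)); exact: to_root (leqnn _).
move=> c c_gt2 cyc_c.
have [x0 x0c] : exists x, x \in c.
  by case: c c_gt2 {cyc_c} => // x c; exists x; rewrite inE eqxx.
(* A highest vertex [x] of the cycle is joined to both of its neighbours there by its own parent
   edge, so these neighbours coincide, which a cycle without repetition excludes. *)
have [x xc xmax] := @arg_maxnP _ x0 (mem c) h x0c.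
have parent y : y \in c -> y != x -> adjacent ends T x y ->
    exists e, [/\ e \in T, top e = x & ends e = [set x; y]].
  move=> yc yx /existsP[e /andP[eT /eqP Ee]]; exists e; split=> //.
  have := lt_h e eT; have := xmax y yc.
  have := Ee; rewrite (Eends e eT) => /set2_eq[[-> _]//|[-> ->]].
  by lia.
have [i p Ep] := rot_to xc.
have mem_p : x :: p =i c by move=> y; rewrite -Ep mem_rot.
have : ucycle (adjacent ends T) (x :: p) by rewrite -Ep rot_ucycle.
have : (2 < size (x :: p))%N by rewrite -Ep size_rot.
case: p mem_p {Ep} => [|y [|z p]] // mem_p _.
case/andP => /=; rewrite rcons_path => /andP[xy /andP[_ /andP[_ zx]]].
move=> /and4P[x_notin y_notin _ _].
set z' := last z p in zx.
have z'p : z' \in z :: p by exact: mem_last.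
have [||e [eT te Ee]] := parent y _ _ xy.
- by rewrite -mem_p !inE eqxx orbT.
- by apply: contraNneq x_notin => ->; rewrite inE eqxx.
have [|||f [fT tf Ef]] := parent z'.
- by rewrite -mem_p in_cons in_cons z'p !orbT.
- by apply: contraNneq x_notin => <-; rewrite in_cons z'p orbT.
- by rewrite adjacent_sym.
have ef : e = f by apply: top_inj => //; rewrite te tf.
have yz : y = z'.
  by move: Ee; rewrite ef Ef => /set2_eq[[]//|[-> ->]].
by move: y_notin; rewrite yz z'p.
Qed.

End Trees.

(** * Comparison gadgets *)

Section Gadget.
Variables (R : realType) (l r : nat).
Local Notation n := (l + (r + r))%N.

(** After the [l] left and [r] right elements come [r] elements fixed at 0, which become the
    subdividing edges of the graph. *)
Definition Lset : {set 'I_n} := [set e : 'I_n | (e < l)%N].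
Definition Rset : {set 'I_n} := [set e : 'I_n | (l <= e < l + r)%N].

Lemma card_Lset : #|Lset| = l.
Proof.
rewrite -[RHS]card_ord -cardsT -(card_imset _ (@lshift_inj l (r + r))).
apply: eq_card => e; rewrite inE; apply/idP/imsetP => [lt_el|[i _ ->]] /=.
  by exists (Ordinal lt_el); rewrite ?inE //; exact: val_inj.
exact: ltn_ord.
Qed.

Lemma card_Rset : #|Rset| = r.
Proof.
have inj : injective (fun j : 'I_r => rshift l (lshift r j) : 'I_n).
  by move=> i j /rshift_inj/lshift_inj.
rewrite -[RHS]card_ord -cardsT -(card_imset _ inj).
apply: eq_card => e; rewrite inE; apply/idP/imsetP => [lt_el|[i _ ->]] /=.
  have lt_er : (e - l < r)%N by lia.
  by exists (Ordinal lt_er); rewrite ?inE //; apply: val_inj => /=; lia.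
by have := ltn_ord i; lia.
Qed.

Lemma disjoint_LR : [disjoint Lset & Rset].
Proof. by apply/pred0P => e; rewrite /= !inE; lia. Qed.

Lemma card_LR : #|Lset :|: Rset| = (l + r)%N.
Proof.
rewrite cardsU disjoint_setI0 ?disjoint_LR // cards0 subn0.
by rewrite card_Lset card_Rset.
Qed.

(** [S] makes it possible to exempt one right element from the lower bound; [0 <= M] keeps extra
    left and right edges of a spanning tree from lowering the bound on its weight. *)
Definition threshold (S : {set 'I_n}) (w : 'I_n -> R) (M : R) : Prop :=
  [/\ 0 <= M, forall e, e \in Lset -> w e <= M,
      forall e, e \in Rset -> e \in S -> M <= w e
    & forall e, e \notin Lset -> e \notin Rset -> w e = 0].

(* The data [D] asks to certify that every element of [Lset] is at most every
   element of [Rset]. *)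
Definition compares_all (P : problem R) (D : data P n) : Prop :=
  (exists a : answer D, forall w M, threshold setT w M -> correct P D w a) /\
  (forall i j (a : answer D) w1 w2 M1 M2, i \in Lset -> j \in Rset ->
     threshold setT w1 M1 -> M1 < w1 j ->
     threshold [set~ j] w2 M2 -> w2 j < w2 i ->
     correct P D w1 a -> correct P D w2 a -> False).

Definition gadget_itv (e : 'I_n) : uncertainty_interval R :=
  if e \in Lset then OpenItv 0 8
  else if e \in Rset then OpenItv 4 12 else TrivialItv 0.

Definition gadget_value (x y : 'I_n -> R) (e : 'I_n) : R :=
  if e \in Lset then x e else if e \in Rset then y e else 0.

Lemma gadget_value_in x y :
  (forall e, 0 < x e /\ x e < 8) -> (forall e, 4 < y e /\ y e < 12) ->
  forall e, in_uitv (gadget_value x y e) (gadget_itv e).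
Proof.
move=> hx hy e; rewrite /gadget_value /gadget_itv.
by case: ifP => _; [exact: hx | case: ifP => _ //; exact: hy].
Qed.

Lemma in_gadget_itv w : (forall e, in_uitv (w e) (gadget_itv e)) ->
  [/\ forall e, e \in Lset -> 0 < w e /\ w e < 8,
      forall e, e \in Rset -> 4 < w e /\ w e < 12
    & forall e, e \notin Lset -> e \notin Rset -> w e = 0].
Proof.
move=> hw; split=> e eL.
- by have := hw e; rewrite /gadget_itv eL.
- have := hw e; rewrite /gadget_itv eL; suff -> : e \in Lset = false by [].
  by apply/negbTE; move: eL; rewrite !inE; lia.
- by move=> eR; have := hw e; rewrite /gadget_itv (negbTE eL) (negbTE eR).
Qed.

Lemma gadget_predicted_in e :
  in_uitv (gadget_value (fun=> 6) (fun=> 10) e) (gadget_itv e).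
Proof. by apply: gadget_value_in => {}e; split; lra. Qed.

(** * Feasible sets and mandatory elements of the gadget *)

Variables (P : problem R) (D : data P n) (cmpD : compares_all D).

Definition gadget : input P :=
  @Input R P n D gadget_itv (gadget_value (fun=> 6) (fun=> 10)) gadget_predicted_in.

Definition gadget_instance w (hw : forall e, in_uitv (w e) (gadget_itv e)) :
  instance P := @Instance R P gadget w hw.

Implicit Types (Q : {set 'I_n}) (E : pred 'I_n).

(** All left values are below 8, so 8 is a threshold for every consistent assignment and one answer
    fits them all. *)
Lemma feasible_Rset w Q : (forall e, e \in Rset -> 8 <= w e) -> Rset \subset Q ->
  @feasible R P gadget w Q.
Proof.
move=> hw /subsetP RQ; have [[a ha] _] := cmpD.
exists a => w' /in_gadget_itv[hL hR hT] agree; apply: (ha _ 8); split=> //.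
- by move=> e /hL[]; lra.
- by move=> e eR _; rewrite agree; [exact: hw | exact: RQ].
Qed.

Lemma feasible_Lset w Q : (forall e, e \in Lset -> w e <= 4) -> Lset \subset Q ->
  @feasible R P gadget w Q.
Proof.
move=> hw /subsetP LQ; have [[a ha] _] := cmpD.
exists a => w' /in_gadget_itv[hL hR hT] agree; apply: (ha _ 4); split=> //.
- by move=> e eL; rewrite agree; [exact: hw | exact: LQ].
- by move=> e /hR[]; lra.
Qed.

(** An answer common to the truth and to the consistent assignment [w2] contradicts the second half
    of [compares_all]: [j] is strictly above the threshold [M] in the truth, but below [i] in
    [w2]. *)
Lemma infeasible w Q M i j : (forall e, in_uitv (w e) (gadget_itv e)) ->
  i \in Lset -> j \in Rset -> 0 <= M <= 7 ->
  (forall e, e \in Lset -> w e <= M) ->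
  (forall e, e \in Rset -> M <= w e) -> M < w j ->
  (forall e, e \in Rset -> e != j -> 7 <= w e) ->
  (if j \in Q then w j else 5) < (if i \in Q then w i else 7) ->
  ~ @feasible R P gadget w Q.
Proof.
move=> hw iL jR /andP[M0 M7] hL hR Mj hR' ltji [a ha].
have [_ sep] := cmpD; have [wL wR wT] := in_gadget_itv hw.
have ij : (i == j) = false.
  by apply/eqP => E; move: iL jR; rewrite E !inE; lia.
(* An unqueried [i] moves to 7 and an unqueried [j] to 5, both in the overlap; then 7 is a threshold
   for [w2] once [j] is exempted. *)
pose w2 e := if e \in Q then w e else if e == i then 7 else if e == j then 5 else w e.
have hw2 e : in_uitv (w2 e) (gadget_itv e).
  rewrite /w2; case: ifP => // _; case: eqP => [->|_].
    by rewrite /gadget_itv iL /=; split; lra.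
  case: eqP => [->|//].
  suff jL : (j \in Lset) = false by rewrite /gadget_itv jL jR /=; split; lra.
  by move: jR; rewrite !inE; lia.
apply: (sep i j a w w2 M 7 iL jR _ Mj); last by apply: ha => // e eQ; rewrite /w2 eQ.
- by split=> // e eR _; exact: hR.
- have [w2L w2R w2T] := in_gadget_itv hw2.
  split=> //.
  + move=> e eL; rewrite /w2; case: ifP => _; first by have := hL e eL; lra.
    case: eqP => // _; case: eqP => _; first by lra.
    by have := hL e eL; lra.
  + move=> e eR; rewrite !inE => ne; have := hR' e eR ne.
    by rewrite /w2 (negbTE ne); case: ifP => // _; case: eqP.
- by move: ltji; rewrite /w2 !eqxx [j == i]eq_sym ij.
- exact: ha.
Qed.

(* [bumped E] is the truth in which the elements of [E], and only those, have a
   value in the overlap of the two kinds of intervals. *)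
Definition bumped (E : pred 'I_n) : 'I_n -> R :=
  gadget_value (fun e => if E e then 6 else 2) (fun e => if E e then 6 else 10).

Lemma bumped_in E e : in_uitv (bumped E e) (gadget_itv e).
Proof. by apply: gadget_value_in => {}e; case: ifP => _; split; lra. Qed.

Lemma bumpedL E e : e \in Lset -> bumped E e = if E e then 6 else 2.
Proof. by rewrite /bumped /gadget_value => ->. Qed.

Lemma bumpedR E e : e \in Rset -> bumped E e = if E e then 6 else 10.
Proof.
move=> eR; rewrite /bumped /gadget_value eR ifN //.
by move: eR; rewrite !inE; lia.
Qed.

Lemma feasible_bumped0 Q : @feasible R P gadget (bumped pred0) Q ->
  (Lset \subset Q) || (Rset \subset Q).
Proof.
move=> fQ; apply/negPn/negP; rewrite negb_or => /andP[].
move=> /subsetPn[i iL iQ] /subsetPn[j jR jQ]; apply: infeasible (fQ) => {fQ}.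
- exact: bumped_in.
- exact: iL.
- exact: jR.
- by instantiate (1 := 4); lra.
- by move=> e eL; rewrite bumpedL //=; lra.
- by move=> e eR; rewrite bumpedR //=; lra.
- by rewrite bumpedR //=; lra.
- by move=> e eR _; rewrite bumpedR //=; lra.
- by rewrite (negbTE iQ) (negbTE jQ); lra.
Qed.

(** An unqueried right [j] may be 5, while [i] is 6 if queried and may be 7 otherwise. *)
Lemma feasible_bumpedL E Q i : i \in Lset -> E i -> (forall e, e \in Rset -> ~~ E e) ->
  @feasible R P gadget (bumped E) Q -> Rset \subset Q.
Proof.
move=> iL Ei ER fQ; apply/subsetP => j jR; apply/negPn/negP => jQ.
apply: infeasible (fQ) => {fQ}.
- exact: bumped_in.
- exact: iL.
- exact: jR.
- by instantiate (1 := 6); lra.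
- by move=> e eL; rewrite bumpedL //; case: ifP => _; lra.
- by move=> e eR; rewrite bumpedR // (negbTE (ER _ eR)); lra.
- by rewrite bumpedR // (negbTE (ER _ jR)); lra.
- by move=> e eR _; rewrite bumpedR // (negbTE (ER _ eR)); lra.
- by rewrite (negbTE jQ) bumpedL // Ei; case: ifP => _; lra.
Qed.

Lemma feasible_bumpedR Q j : j \in Rset ->
  @feasible R P gadget (bumped (pred1 j)) Q -> Lset \subset Q.
Proof.
move=> jR fQ; apply/subsetP => i iL; apply/negPn/negP => iQ.
apply: infeasible (fQ) => {fQ}.
- exact: bumped_in.
- exact: iL.
- exact: jR.
- by instantiate (1 := 4); lra.
- move=> e eL; rewrite bumpedL // ifN; first by lra.
  by apply: contraTneq eL => ->; move: jR; rewrite !inE; lia.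
- by move=> e eR; rewrite bumpedR //; case: ifP => _; lra.
- by rewrite bumpedR // /= eqxx; lra.
- by move=> e eR ne; rewrite bumpedR //= (negbTE ne); lra.
- by rewrite (negbTE iQ) bumpedR //= eqxx; case: ifP => _; lra.
Qed.

Lemma mandatory_bumpedL E i : i \in Lset -> E i -> (forall e, e \in Rset -> ~~ E e) ->
  @mandatory_set R P gadget (bumped E) = Rset.
Proof.
move=> iL Ei ER; apply/setP => e; apply/idP/idP => [|eR].
  rewrite inE => /asboolP; apply; apply: feasible_Rset => // f fR.
  by rewrite bumpedR // (negbTE (ER _ fR)); lra.
rewrite inE; apply/asboolP => Q fQ.
exact: (subsetP (feasible_bumpedL iL Ei ER fQ)).
Qed.

(** The prediction is itself a bumped assignment, with the whole left side in the overlap, so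
    [mandatory_bumpedL] describes both [I_P] and [I_R]. *)
Lemma gadget_predictedE : @predicted R P gadget = bumped (fun e => e \in Lset).
Proof.
by apply: funext => e; rewrite /= /bumped /gadget_value; case: ifP.
Qed.

Lemma k_M_bumpedL i : i \in Lset -> k_M (gadget_instance (bumped_in (pred1 i))) = 0%N.
Proof.
move=> iL; rewrite /k_M.
have -> : I_P (gadget_instance (bumped_in (pred1 i))) = Rset.
  rewrite -(@mandatory_bumpedL (fun e => e \in Lset) i) //.
    by rewrite -gadget_predictedE.
  by move=> e; rewrite !inE; lia.
have -> : I_R (gadget_instance (bumped_in (pred1 i))) = Rset.
  apply: (@mandatory_bumpedL (pred1 i) i) => //= e eR.
  by apply: contraTneq eR => ->; move: iL; rewrite !inE; lia.
by rewrite setDv setU0 cards0.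
Qed.

Lemma bumped_pred1 i e : e != i -> bumped (pred1 i) e = bumped pred0 e.
Proof. by move=> /negbTE ne; rewrite /bumped /gadget_value /= ne. Qed.

(** * Runs of the algorithm against the adversary *)

Variable A : algorithm P.

(** Simulated runs ignore feasibility and stay put once the algorithm gives up, so there is a
    history at every time. *)
Definition step (w : 'I_n -> R) (h : seq ('I_n * R)) : seq ('I_n * R) :=
  if A (J := gadget) h is Some i then rcons h (i, w i) else h.

Definition hist w t := iter t (step w) [::].

Definition queried w t : {set 'I_n} := [set i in unzip1 (hist w t)].

Lemma alg_cost_feasible w (hw : forall e, in_uitv (w e) (gadget_itv e)) h k :
  @alg_cost R P A (gadget_instance hw) h k ->
  @feasible R P gadget w [set i in unzip1 (iter k (step w) h)].
Proof.
elim=> // {}h i {}k _ Ai _ IHk; rewrite iterSr.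
suff -> : step w h = rcons h (i, w i) by [].
by rewrite /step (_ : A (J := gadget) h = Some i).
Qed.

Lemma card_queried w t : (#|queried w t| <= t)%N.
Proof.
rewrite /queried cardsE; apply: leq_trans (card_size _) _.
rewrite size_map /hist; elim: t => //= t IHt.
rewrite {1}/step; case: (A _) => [i|]; last exact: leqW.
by rewrite size_rcons ltnS.
Qed.

Lemma queriedS w t : queried w t.+1 =
  if A (J := gadget) (hist w t) is Some i then i |: queried w t else queried w t.
Proof.
apply/setP => e; rewrite inE /hist /= {1}/step -/(hist w t).
case: (A _) => [i|]; last by rewrite inE.
by rewrite /unzip1 map_rcons mem_rcons !inE.
Qed.

Lemma queried_mono w s t : (s <= t)%N -> queried w s \subset queried w t.
Proof.
move=> /subnK <-; elim: (t - s)%N => // k IHk; apply: subset_trans IHk _.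
by rewrite addSn queriedS; case: (A _) => // i; exact: subsetUr.
Qed.

Lemma hist_bumped e s : e \notin queried (bumped pred0) s ->
  hist (bumped (pred1 e)) s = hist (bumped pred0) s.
Proof.
elim: s => // s IHs es.
have es' : e \notin queried (bumped pred0) s.
  by apply: contra es; apply/subsetP/queried_mono.
rewrite /hist /= -!/(hist _ _) IHs // /step.
move: es; rewrite queriedS; case: (A _) => // i; rewrite in_setU1 negb_or.
by move=> /andP[ei _]; rewrite bumped_pred1 // eq_sym.
Qed.

(* Until [e] is queried the two truths [bumped pred0] and [bumped (pred1 e)] are
   indistinguishable; after that, the side opposite to [e] is mandatory although
   the whole side of [e] has already been queried. *)
Lemma all_queried e s k (B C : {set 'I_n}) :
  A (J := gadget) (hist (bumped pred0) s) = Some e ->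
  e \notin queried (bumped pred0) s ->
  B \subset queried (bumped pred0) s.+1 ->
  ~~ (C \subset queried (bumped pred0) s) ->
  C \subset queried (bumped (pred1 e)) k ->
  (#|B :|: C| <= k)%N.
Proof.
move=> Ae es BQ CQ CQk.
apply: leq_trans (card_queried (bumped (pred1 e)) k).
apply: subset_leq_card; rewrite subUset CQk andbT.
(* If [s < k], both truths lead to the same queries up to and including [e], so [B] is covered by
   time [k]. If [k <= s], the two runs agree up to time [k], and [C] would be covered by time
   [s]. *)
have [lt_sk|le_ks] := ltnP s k.
  apply: subset_trans BQ _; apply: subset_trans (queried_mono _ lt_sk).
  by rewrite !queriedS hist_bumped // Ae /queried hist_bumped.
case/negP: CQ; apply: subset_trans CQk _.
have ek : e \notin queried (bumped pred0) k.
  by apply: contra es; apply/subsetP/queried_mono.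
by rewrite /queried hist_bumped //; exact: queried_mono.
Qed.

Lemma opt_gadget_le w (hw : forall e, in_uitv (w e) (gadget_itv e)) Q :
  @feasible R P gadget w Q -> (opt (gadget_instance hw) <= #|Q|)%N.
Proof.
move=> fQ; rewrite /opt; case: arg_minnP => [|Q' _]; last by apply; apply/asboolP.
(* The default of the minimum, the full set, is feasible because [Q] is. *)
apply/asboolP; have [a ha] := fQ; exists a => w' hw' agree; apply: ha => // e _.
by apply: agree; rewrite inE.
Qed.

Lemma tradeoff rho beta : (0 < l)%N -> (0 < r)%N ->
  competitive_on A (fun I => k_M I = 0%N) rho -> robust A beta ->
  (l + r)%:R <= rho * r%:R \/ (l + r)%:R <= beta * l%:R.
Proof.
move=> l0 r0 comp rob.
(* The run against [bumped pred0] is followed to the first time at which it covers a whole side;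
   robustness on that truth ensures that there is one. *)
pose cov t := (Lset \subset queried (bumped pred0) t)
              || (Rset \subset queried (bumped pred0) t).
have exc : exists t, cov t.
  have [k [/alg_cost_feasible/feasible_bumped0 ck _]] :=
    rob (gadget_instance (bumped_in pred0)) I.
  by exists k.
have cost_le (x : R) k o b : (l + r <= k)%N -> (o <= b)%N ->
    k%:R <= x * o%:R -> (l + r)%:R <= x * b%:R.
  move=> lrk ob kxo; have lr0 : 0 < (l + r)%:R :> R by rewrite ltr0n addn_gt0 l0.
  have lrk' : (l + r)%:R <= k%:R :> R by rewrite ler_nat.
  have ob' : o%:R <= b%:R :> R by rewrite ler_nat.
  have o0 : 0 <= o%:R :> R by rewrite ler0n.
  have x0 : 0 <= x by rewrite leNgt; apply/negP => x0; nra.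
  have := ler_wpM2l x0 ob'; lra.
case: (ex_minnP exc) => [[|s]] cs mins.
  have e0 : queried (bumped pred0) 0 = set0 by apply/setP => e; rewrite !inE.
  by move: cs; rewrite /cov e0 !subset0 -!cards_eq0 card_Lset card_Rset; lia.
have /norP[nL nR] : ~~ cov s by apply/negP => /mins; rewrite ltnn.
case Ae: (A (J := gadget) (hist (bumped pred0) s)) => [e|]; last first.
  by move: cs; rewrite /cov queriedS Ae (negbTE nL) (negbTE nR).
have es : e \notin queried (bumped pred0) s.
  apply: contraL cs => es; rewrite /cov queriedS Ae.
  by rewrite (setUidPr _) ?sub1set // (negbTE nL) (negbTE nR).
(* The step from [s] to [s.+1] adds only [e], so a side first covered by it contains [e]. *)
have last_in (B : {set 'I_n}) : B \subset queried (bumped pred0) s.+1 ->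
    ~~ (B \subset queried (bumped pred0) s) -> e \in B.
  move=> BQ /subsetPn[f fB fs]; move: (subsetP BQ _ fB).
  by rewrite queriedS Ae in_setU1 (negbTE fs) orbF => /eqP <-.
case/orP: cs => [LQ|RQ].
  left; have eL := last_in _ LQ nL.
  have nE f : f \in Rset -> ~~ pred1 e f.
    by move=> fR; apply: contraTneq fR => ->; move: eL; rewrite !inE; lia.
  have [k [ck kx]] := comp _ (k_M_bumpedL eL).
  have kR := feasible_bumpedL (E := pred1 e) eL (eqxx e) nE (alg_cost_feasible ck).
  apply: cost_le kx.
    by rewrite -card_LR; exact: all_queried LQ nR kR.
  rewrite -[leqRHS]card_Rset; apply: opt_gadget_le; apply: feasible_Rset => // f fR.
  by rewrite bumpedR // (negbTE (nE _ fR)); lra.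
right; have eR := last_in _ RQ nR.
have nE f : f \in Lset -> ~~ pred1 e f.
  by move=> fR; apply: contraTneq fR => ->; move: eR; rewrite !inE; lia.
have [k [ck kx]] := rob (gadget_instance (bumped_in (pred1 e))) I.
have kL := feasible_bumpedR eR (alg_cost_feasible ck).
apply: cost_le kx.
  by rewrite -card_LR setUC; exact: all_queried RQ nL kL.
rewrite -[leqRHS]card_Lset; apply: opt_gadget_le; apply: feasible_Lset => // f fL.
by rewrite bumpedL // (negbTE (nE _ fL)); lra.
Qed.

End Gadget.

(** * The three problems as gadgets *)

Section SetFamilies.
Variables (R : realType) (l r : nat).
Local Notation n := (l + (r + r))%N.
Local Notation LR := (setX (Lset l r) (Rset l r)).

Definition pair_of (k : 'I_#|LR|) : 'I_n * 'I_n := enum_val k.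

Lemma pair_ofP k : (pair_of k).1 \in Lset l r /\ (pair_of k).2 \in Rset l r.
Proof. by have := enum_valP k; rewrite inE => /andP[]. Qed.

Lemma pair_of_onto i j : i \in Lset l r -> j \in Rset l r ->
  exists k, pair_of k = (i, j).
Proof.
move=> iL jR; have ijLR : (i, j) \in LR by rewrite inE iL jR.
by exists (enum_rank_in ijLR (i, j)); exact: enum_rankK_in.
Qed.

Lemma pair_neq k : (pair_of k).1 != (pair_of k).2.
Proof.
have [iL jR] := pair_ofP k; apply: contraTneq iL => ->.
by move: jR; rewrite !inE; lia.
Qed.

Definition pair_member (k : 'I_#|LR|) : {set 'I_n} :=
  [set (pair_of k).1; (pair_of k).2].

Lemma pair_member_neq0 k : pair_member k != set0.
Proof. by apply/set0Pn; exists (pair_of k).1; rewrite set21. Qed.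

Definition pair_family : set_family n := SetFamily pair_member_neq0.

Lemma threshold_pair (w : 'I_n -> R) M k : threshold setT w M ->
  w (pair_of k).1 <= w (pair_of k).2.
Proof.
have [iL jR] := pair_ofP k; move=> [_ hL hR _].
by apply: le_trans (hL _ iL) (hR _ jR _); rewrite inE.
Qed.

(** On the pair of [i] and [j], the values [w1] exclude [j] as a minimum and [w2] exclude [i]. *)
Lemma minimum_compares_all : @compares_all R l r (minimum_problem R) pair_family.
Proof.
split.
  exists (fun k => (pair_of k).1) => w M thr k; split; first exact: set21.
  by move=> i /set2P[->|->] //; exact: threshold_pair thr.
move=> i j a w1 w2 M1 M2 iL jR [_ hL _ _] M1j _ w2ji c1 c2.
have [k Ek] := pair_of_onto iL jR.
have iS : i \in pair_member k by rewrite /pair_member Ek set21.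
have jS : j \in pair_member k by rewrite /pair_member Ek set22.
have [aS m1] := c1 k; have [_ m2] := c2 k.
have := m1 i iS; have := m2 j jS; have := hL i iL.
by move: aS; rewrite /= /pair_member Ek => /set2P[->|->]; lra.
Qed.

(** The pair is listed in one of two orders; [w2] rules out [i] first and [w1] rules out [j]
    first. *)
Lemma sorting_compares_all : @compares_all R l r (sorting_problem R) pair_family.
Proof.
have perm_pair k : perm_eq [:: (pair_of k).1; (pair_of k).2] (enum (pair_member k)).
  apply: uniq_perm; rewrite ?enum_uniq //= ?inE ?pair_neq //.
  by move=> e; rewrite mem_enum !inE.
split.
  exists (fun k => [:: (pair_of k).1; (pair_of k).2]) => w M thr k.
  by split; [exact: perm_pair | rewrite /= andbT; exact: threshold_pair thr].
move=> i j a w1 w2 M1 M2 iL jR [_ hL _ _] M1j _ w2ji c1 c2.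
have [k Ek] := pair_of_onto iL jR.
have [pk s1] := c1 k; have [_ s2] := c2 k; have := hL i iL.
have : perm_eq (a k) [:: i; j].
  by apply: perm_trans pk _; rewrite perm_sym; have := perm_pair k; rewrite /= Ek.
move: s1 s2 => /=; case: (a k) => [|x [|y [|z s]]] s1 s2 Ep;
  have := perm_size Ep => //= _.
have xS : x \in [:: i; j] by rewrite -(perm_mem Ep) !inE eqxx.
have yS : y \in [:: i; j] by rewrite -(perm_mem Ep) !inE eqxx orbT.
have iS : i \in [:: x; y] by rewrite (perm_mem Ep) !inE eqxx.
have jS : j \in [:: x; y] by rewrite (perm_mem Ep) !inE eqxx orbT.
move: s1 s2 => /=; rewrite !andbT; move: xS yS iS jS; rewrite !inE.
move=> /orP[]/eqP-> /orP[]/eqP->; rewrite ?orbb; try by move=> *; lra.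
- by move=> _ /eqP E; move: w2ji; rewrite E ltxx.
- by move=> /eqP E; move: w2ji; rewrite E ltxx.
Qed.

End SetFamilies.

(** * Spanning trees: a path with subdivided parallel edges *)

Section CycleGraph.
Variables (R : realType) (l r : nat).
Hypothesis l_gt0 : (0 < l)%N.
Local Notation n := (l + (r + r))%N.
Local Notation m := (l + r).+1.

(* The edges of [Lset] form the path 0 - 1 - ... - l; the vertices l + 1 .. l + r
   are joined to l by the edges of [Rset] and to 0 by edges of weight zero. *)
Definition lo (e : nat) : nat :=
  if (e < l)%N then e else if (e < l + r)%N then l else 0%N.
Definition hi (e : nat) : nat :=
  if (e < l)%N then e.+1 else if (e < l + r)%N then e.+1 else (e - r).+1.

Lemma lo_hiP e : [\/ [/\ (e < l)%N, lo e = e & hi e = e.+1],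
  [/\ (l <= e < l + r)%N, lo e = l & hi e = e.+1]
  | [/\ (l + r <= e)%N, lo e = 0%N & hi e = (e - r).+1]].
Proof.
rewrite /lo /hi; case: (ltnP e l) => lel; first by constructor 1.
by case: (ltnP e (l + r)) => ler; [constructor 2 | constructor 3]; split.
Qed.

Lemma lo_lt_hi (e : 'I_n) : (lo e < hi e < m)%N.
Proof. by have := ltn_ord e; rewrite /lo /hi; do ?case: ifP => ?; lia. Qed.

Definition cycle_ends (e : 'I_n) : {set 'I_m} := [set inord (lo e); inord (hi e)].

Lemma val_lo (e : 'I_n) : (inord (lo e) : 'I_m) = lo e :> nat.
Proof. by rewrite inordK //; have := lo_lt_hi e; lia. Qed.

Lemma val_hi (e : 'I_n) : (inord (hi e) : 'I_m) = hi e :> nat.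
Proof. by rewrite inordK //; have := lo_lt_hi e; lia. Qed.

Lemma card_cycle_ends e : #|cycle_ends e| = 2%N.
Proof.
rewrite cards2; suff -> : (inord (lo e) : 'I_m) != inord (hi e) by [].
by apply/eqP => /(congr1 val) /=; rewrite val_lo val_hi; have := lo_lt_hi e; lia.
Qed.

(** Since [lo] is below [hi], equal edges agree in both; [l_gt0] keeps apart the two edges at a
    vertex beyond [l], which run to [l] and to 0. *)
Lemma cycle_ends_inj : injective cycle_ends.
Proof.
move=> e f /set2_eq[[]|[]] /(congr1 val) /= + /(congr1 val) /=;
  rewrite !val_lo !val_hi => E1 E2; apply: val_inj => /=; move: E1 E2;
  have := lo_lt_hi e; have := lo_lt_hi f; have := ltn_ord e; have := ltn_ord f;
  rewrite /lo /hi; do ?case: ifP => ?; lia.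
Qed.

Definition base_tree : {set 'I_n} := ~: Rset l r.

Lemma base_treeP : spanning_tree cycle_ends base_tree.
Proof.
apply: (@parents_spanning_tree _ _ _ _ (fun e => inord (hi e)) (fun e => inord (lo e))
          (@nat_of_ord m) ord0) => [e _|e _|e f|v v0].
- exact: setUC.
- by rewrite val_lo val_hi; have := lo_lt_hi e; lia.
- rewrite !inE => eT fT /(congr1 val) /=; rewrite !val_hi => E; apply: val_inj => /=.
  have := ltn_ord e; have := ltn_ord f; move: E eT fT.
  by rewrite /hi; do ?case: ifP => ?; lia.
- have v_gt0 : (0 < v)%N by rewrite lt0n; apply: contra v0 => /eqP E; apply/eqP/val_inj.
  have lt_vm := ltn_ord v.
  have [le_vl|lt_lv] := leqP v l.
    have lt_n : (v.-1 < n)%N by lia.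
    exists (Ordinal lt_n); first by rewrite !inE /=; lia.
    by apply: ord_inj; rewrite val_hi /= /hi; do ?case: ifP => ?; lia.
  have lt_n : (v.-1 + r < n)%N by lia.
  exists (Ordinal lt_n); first by rewrite !inE /=; lia.
  by apply: ord_inj; rewrite val_hi /= /hi; do ?case: ifP => ?; lia.
Qed.

Lemma cycle_connected : connected_graph cycle_ends [set: 'I_n].
Proof.
move=> u v; have [conn _] := base_treeP; have := conn u v.
apply: connect_sub => x y /existsP[e /andP[_ Ee]]; apply: connect1.
by apply/existsP; exists e; rewrite inE.
Qed.

Definition cycle_graph : graph n :=
  @Graph n m cycle_ends (ltn0Sn _) card_cycle_ends cycle_ends_inj cycle_connected.

Definition swapped_tree (i j : 'I_n) : {set 'I_n} := j |: (base_tree :\ i).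

(* Deleting edge [i] hangs the part i + 1 .. l of the path upside down below [j]. *)
Lemma swapped_treeP i j : i \in Lset l r -> j \in Rset l r ->
  spanning_tree cycle_ends (swapped_tree i j).
Proof.
rewrite !inE => iL jR.
(* Tree edges with [up] have their lower-numbered end as child: beyond [i] the path is traversed
   towards [l], and [j] leads from [l] to an outer vertex hanging on the root. Outer vertices thus
   get height 1 and [l] height 2, increasing from there back to [i.+1]. *)
pose up (e : 'I_n) := (i < e < l + r)%N.
pose h (v : 'I_m) :=
  if (v <= i)%N then v : nat else if (v <= l)%N then (l - v).+2 else 1%N.
have inT e : e \in swapped_tree i j ->
    [\/ (e < i)%N, (i < e < l)%N, e = j :> nat | (l + r <= e)%N].
  rewrite !inE => /orP[/eqP->|/andP[/eqP ne eR]]; first by constructor 3.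
  case: (ltngtP e i) => [lt_ei|lt_ie|/val_inj//]; first by constructor 1.
  by case: (ltnP e l) => ?; [constructor 2 | constructor 4]; lia.
apply: (@parents_spanning_tree _ _ _ _
    (fun e => if up e then inord (lo e) else inord (hi e))
    (fun e => if up e then inord (hi e) else inord (lo e)) h ord0).
- by move=> e _; case: ifP => // _; exact: setUC.
- move=> e /inT eT; have := ltn_ord e.
  case upe: (up e); rewrite /h val_lo val_hi; move: upe; rewrite /up;
    have [[? -> ->]|[? -> ->]|[? -> ->]] := lo_hiP e;
    case: eT => ?; rewrite ?leq0n; do ?case: ifP => ?; lia.
- move=> e f /inT eT /inT fT E; apply: ord_inj.
  move: E (ltn_ord e) (ltn_ord f); case upe: (up e); case upf: (up f);
    move=> /(congr1 (@nat_of_ord m)); rewrite ?val_lo ?val_hi;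
    move: upe upf; rewrite /up; case: (lo_hiP e) => -[? ? ?]; case: (lo_hiP f) => -[? ? ?];
    case: eT => ?; case: fT => ?; lia.
- move=> v v0.
  have v_gt0 : (0 < v)%N by rewrite lt0n; apply: contra v0 => /eqP E; apply/eqP/val_inj.
  have lt_vm := ltn_ord v.
  have [le_vi|lt_iv] := leqP v i.
    have lt_n : (v.-1 < n)%N by lia.
    exists (Ordinal lt_n); first by rewrite !inE -!val_eqE /=; lia.
    rewrite ifN; last by rewrite /up /=; lia.
    by apply: ord_inj; rewrite val_hi /= /hi; do ?case: ifP => ?; lia.
  have [lt_vl|] := ltnP v l.
    have lt_n : (v < n)%N by lia.
    exists (Ordinal lt_n); first by rewrite !inE -!val_eqE /=; lia.
    rewrite ifT; last by rewrite /up /=; lia.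
    by apply: ord_inj; rewrite val_lo /= /lo; do ?case: ifP => ?; lia.
  rewrite leq_eqVlt => /orP[/eqP Ev|lt_lv].
    exists j; first by rewrite !inE eqxx.
    rewrite ifT; last by rewrite /up; lia.
    by apply: ord_inj; rewrite val_lo /= /lo; do ?case: ifP => ?; lia.
  have lt_n : (v.-1 + r < n)%N by lia.
  exists (Ordinal lt_n); first by rewrite !inE -!val_eqE /=; lia.
  rewrite ifN; last by rewrite /up /=; lia.
  by apply: ord_inj; rewrite val_hi /= /hi; do ?case: ifP => ?; lia.
Qed.

Lemma sum_base_tree (w : 'I_n -> R) M S : threshold S w M ->
  \sum_(e in base_tree) w e = \sum_(e in Lset l r) w e.
Proof.
move=> [_ _ _ w0]; rewrite (bigID (mem (Lset l r))) /= [X in _ + X]big1 ?addr0.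
  apply: eq_bigl => e; rewrite !inE; lia.
by move=> e /andP[eB eL]; apply: w0 => //; move: eB; rewrite inE.
Qed.

(* Subtract [M] from every weight of [Lset] and [Rset]: a spanning tree has at
   least [l] of these edges, and dropping an edge of [Lset] only costs. *)
Lemma tree_weight_ge (w : 'I_n -> R) M S (T : {set 'I_n}) : threshold S w M ->
  spanning_tree cycle_ends T ->
  \sum_(e in Lset l r) w e + \sum_(e in T :&: Rset l r) (w e - M)
    <= \sum_(e in T) w e.
Proof.
move=> [M0 hL _ w0] [conn _].
have cT := connected_card conn.
pose N := Lset l r :|: Rset l r.
(* [T] has at least [l + r] edges, and only the [r] edges of weight 0 lie outside [N]. *)
have cTN : (l <= #|T :&: N|)%N.
  have := cardsID N T; have : (#|T :\: N| <= #|~: N|)%N.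
    by apply: subset_leq_card; rewrite setDE subsetIr.
  by have := cardsC N; rewrite card_LR card_ord; lia.
have -> : \sum_(e in T) w e = \sum_(e in T :&: N) w e.
  rewrite (bigID (mem N)) /= [X in _ + X]big1 ?addr0.
    by apply: eq_bigl => e; rewrite !inE.
  by move=> e /andP[_]; rewrite inE negb_or => /andP[eL eR]; exact: w0.
have -> : \sum_(e in T :&: N) w e = \sum_(e in T :&: N) (w e - M) + M *+ #|T :&: N|.
  by rewrite -sumr_const -big_split /=; apply: eq_bigr => e _; rewrite subrK.
have -> : \sum_(e in Lset l r) w e = \sum_(e in Lset l r) (w e - M) + M *+ l.
  rewrite -[X in M *+ X](card_Lset l r) -sumr_const -big_split /=.
  by apply: eq_bigr => e _; rewrite subrK.
have -> : \sum_(e in T :&: N) (w e - M) =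
    \sum_(e in T :&: Lset l r) (w e - M) + \sum_(e in T :&: Rset l r) (w e - M).
  rewrite -bigU /=.
    by apply: eq_bigl => e; rewrite !inE andb_orr.
  exact: disjointW (subsetIr _ _) (subsetIr _ _) (disjoint_LR l r).
have : \sum_(e in Lset l r) (w e - M) <= \sum_(e in T :&: Lset l r) (w e - M).
  rewrite (bigID (mem T)) /= [leRHS](_ : _ = \sum_(e in Lset l r | e \in T) (w e - M)).
    rewrite gerDl; apply: sumr_le0 => e /andP[eL _].
    by rewrite subr_le0; exact: hL.
  by apply: eq_bigl => e; rewrite !inE andbC.
have : M *+ l <= M *+ #|T :&: N| by apply: ler_wpMn2l.
lra.
Qed.

(** Under [w1], a spanning tree through [j] outweighs [base_tree] by at least [w1 j - M1], so the
    answer avoids [j]. Under [w2], a tree avoiding [j] weighs at least as much as [base_tree], which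
    exchanging [i] for [j] makes strictly lighter. *)
Lemma mst_compares_all : @compares_all R l r (mst_problem R) cycle_graph.
Proof.
split.
  exists base_tree => w M thr; split; first exact: base_treeP.
  move=> T sT; apply: le_trans (tree_weight_ge thr sT).
  rewrite (sum_base_tree thr) lerDl; case: thr => [_ _ hR _].
  apply: sumr_ge0 => e; rewrite inE => /andP[_ eR].
  by rewrite subr_ge0; apply: hR => //; rewrite inE.
move=> i j T w1 w2 M1 M2 iL jR thr1 M1j thr2 w2ji [sT min1] [_ min2].
have jT : j \notin T.
  apply/negP => jT; have := min1 _ base_treeP.
  have := tree_weight_ge thr1 sT; rewrite (sum_base_tree thr1).
  case: thr1 => [_ _ hR _].
  rewrite [X in _ + X <= _](bigD1 j) /=; last by rewrite inE jT.
  have : 0 <= \sum_(e in T :&: Rset l r | e != j) (w1 e - M1).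
    apply: sumr_ge0 => e /andP[]; rewrite inE => /andP[_ eR] _.
    by rewrite subr_ge0; apply: hR => //; rewrite inE.
  lra.
have := min2 _ (swapped_treeP iL jR).
have := tree_weight_ge thr2 sT; rewrite -(sum_base_tree thr2).
have : 0 <= \sum_(e in T :&: Rset l r) (w2 e - M2).
  case: thr2 => [_ _ hR _]; apply: sumr_ge0 => e; rewrite inE => /andP[eT eR].
  by rewrite subr_ge0; apply: hR => //; rewrite !inE; apply: contraNneq jT => <-.
have iB : i \in base_tree by move: iL; rewrite !inE; lia.
have jB : j \notin base_tree :\ i by move: jR; rewrite !inE => ->; rewrite andbF.
rewrite /swapped_tree (big_setU1 _ jB) (big_setD1 _ iB) /=.
lra.
Qed.

End CycleGraph.

(** * From the trade-off to the two bounds *)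

Lemma problem_tradeoff (R : realType) (p : problem_kind)
    (A : algorithm (problem_of R p)) (rho beta : R) (l r : nat) :
  (0 < l)%N -> (0 < r)%N ->
  competitive_on A (fun I => k_M I = 0%N) rho -> robust A beta ->
  (l + r)%:R <= rho * r%:R \/ (l + r)%:R <= beta * l%:R.
Proof.
move=> l0 r0; case: p A => A; apply: tradeoff => //.
- exact: minimum_compares_all.
- exact: sorting_compares_all.
- exact: mst_compares_all.
Qed.

(** For large [N] the constants [z] and [t] become negligible. Starting at 2 keeps
    [(c - d) * N.+2 - 1], a number of right elements used below, positive. *)
Lemma ler_of_affine (R : realType) (x y z t : R) :
  (forall N : nat, x * N.+2%:R + z <= y * N.+2%:R + t) -> x <= y.
Proof.
move=> h; rewrite leNgt; apply/negP => lt_yx.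
have d0 : 0 < x - y by lra.
pose N := Num.bound `|(t - z) / (x - y)|.
have : (t - z) / (x - y) < N%:R.
  exact: le_lt_trans (ler_norm _) (archi_boundP (normr_ge0 _)).
rewrite ltr_pdivrMr // => hN; have := h N.
have : (N%:R : R) <= N.+2%:R by rewrite ler_nat; lia.
nra.
Qed.

Theorem theorem3 (R : realType) (gamma : rat) (hgamma : 2 <= gamma)
    (p : problem_kind) (A : algorithm (problem_of R p)) :
  (robust A (ratr gamma) ->
   forall rho : R,
     competitive_on A (fun I => k_M I = 0%N) rho ->
     1 + 1 / (ratr gamma - 1) <= rho)
  /\
  (competitive_on A (fun I => k_M I = 0%N) (1 + 1 / (ratr gamma - 1)) ->
   forall beta : R, robust A beta -> ratr gamma <= beta).
Proof.
(* With [gamma = c / d], the sizes [l = d * N] and [r = (c - d) * N] give exactly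
   [(l + r) / l = gamma] and [(l + r) / r = 1 + 1 / (gamma - 1)]; each bound changes [r] by one. *)
have [c [d [d0 cd Eg]]] : exists c d : nat,
    [/\ (0 < d)%N, (2 * d <= c)%N & ratr gamma = c%:R / d%:R :> R].
  have g2 : 2 <= ratr gamma :> R by rewrite -(ratr_nat R 2) ler_rat.
  have g0 : 0 <= gamma by apply: le_trans hgamma.
  exists `|numq gamma|%N, `|denq gamma|%N.
  have d0 : (0 < `|denq gamma|)%N by rewrite absz_gt0 denq_neq0.
  have Eg : ratr gamma = `|numq gamma|%N%:R / `|denq gamma|%N%:R :> R.
    by rewrite /ratr !pmulrn !gez0_abs ?numq_ge0.
  split=> //; move: g2; rewrite Eg ler_pdivlMr ?ltr0n //.
  by rewrite -natrM ler_nat.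
have d0' : 0 < d%:R :> R by rewrite ltr0n.
have cd' : 2 * d%:R <= c%:R :> R by rewrite -natrM ler_nat.
have -> : 1 + 1 / (ratr gamma - 1) = c%:R / (c%:R - d%:R) :> R.
  by rewrite Eg; field; apply/andP; split; rewrite gt_eqF //; lra.
have cd0 : 0 < c%:R - d%:R :> R by lra.
have Er N : ((c - d) * N)%:R = (c%:R - d%:R) * N%:R :> R by rewrite natrM natrB //; lia.
rewrite Eg; split=> [rob rho comp|comp beta rob].
  (* One more right element makes [l + r] exceed [gamma * l], which leaves the bound on [rho]. *)
  rewrite ler_pdivrMr //; apply: (@ler_of_affine _ _ _ 1 rho) => N.
  have [||le1|le2] := @problem_tradeoff R p A rho (c%:R / d%:R) (d * N.+2)
    ((c - d) * N.+2).+1 _ _ comp rob.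
  - by rewrite muln_gt0 d0.
  - by [].
  - by move: le1; rewrite natrD -[(_ * _).+1%:R]natr1 Er natrM; lra.
  - move: le2; rewrite natrD -[(_ * _).+1%:R]natr1 Er natrM mulrA.
    by rewrite divfK ?gt_eqF //; lra.
(* One right element fewer lowers [l + r] by 1 but [c / (c - d) * r] by more than 1, which leaves
   the bound on [beta]. *)
rewrite ler_pdivrMr //; apply: (@ler_of_affine _ _ _ (-1) 0) => N.
have gt1 : (1 < (c - d) * N.+2)%N.
  by apply: (@leq_trans N.+2); rewrite ?leq_pmull //; lia.
have ge1 := ltnW gt1.
have [||le2|le3] := @problem_tradeoff R p A (c%:R / (c%:R - d%:R)) beta (d * N.+2)
    ((c - d) * N.+2).-1 _ _ comp rob.
- by rewrite muln_gt0 d0.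
- by move: gt1; case: (_ * _)%N => [|[]].
- move: le2; rewrite -subn1 natrD natrB // Er natrM mulrBr mulrA divfK ?gt_eqF // mulr1.
  suff : 1 < c%:R / (c%:R - d%:R) :> R by lra.
  by rewrite ltr_pdivlMr //; lra.
- by move: le3; rewrite -subn1 natrD natrB // Er natrM; lra.
Qed.
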